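(* Let $T$ be a $k$-tree and $C$ a $k$-clique of $T$. Then $\mu(T;C)<2\mu(T)$.
   Context: A $k$-tree is defined recursively: $K_k$ is a $k$-tree, and if $T$ is a $k$-tree then so is the graph obtained by joining a new vertex to all vertices of some $k$-clique of $T$; there are no others. A sub-$k$-tree of $T$ is a subgraph that is itself a $k$-tree. $\mu(T)$ is the average number of vertices over all sub-$k$-trees of $T$; $\mu(T;C)$ is the average number of vertices over all sub-$k$-trees of $T$ that contain $C$. *)

(* Defs.v *)
From HB Require Import structures.
From mathcomp Require Import all_boot all_order all_algebra.
From mathcomp Require Import boolp.

Set Implicit Arguments. Unset Strict Implicit. Unset Printing Implicit Defensive.
Import Order.TTheory GRing.Theory Num.Theory.

(* A (finite simple) graph on a vertex type V is a pair (S, E) with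
   S : {set V} the vertex set and E : {set {set V}} the edge set, each edge
   being a 2-element subset of S. *)

Definition complete_edges (V : finType) (S : {set V}) : {set {set V}} :=
  [set e : {set V} | (e \subset S) && (#|e| == 2)].

Definition is_clique (V : finType) (E : {set {set V}}) (C : {set V}) : Prop :=
  forall x y, x \in C -> y \in C -> x != y -> [set x; y] \in E.

Inductive ktree (k : nat) (V : finType) : {set V} -> {set {set V}} -> Prop :=
| ktree_base (S : {set V}) :
    #|S| = k -> ktree k S (complete_edges S)
| ktree_step (S : {set V}) (E : {set {set V}}) (C : {set V}) (v : V) :
    ktree k S E -> v \notin S -> C \subset S -> #|C| = k -> is_clique E C ->
    ktree k (v |: S) (E :|: [set [set v; c] | c in C]).

Definition subgraph (V : finType) (VT : {set V}) (ET : {set {set V}})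
  (S : {set V}) (F : {set {set V}}) : Prop :=
  [/\ S \subset VT, F \subset ET & forall e, e \in F -> e \subset S].

Definition is_kclique (k : nat) (V : finType) (VT : {set V}) (ET : {set {set V}})
  (C : {set V}) : Prop :=
  [/\ C \subset VT, #|C| = k & is_clique ET C].

Definition subktrees (k : nat) (V : finType) (VT : {set V}) (ET : {set {set V}})
  : {set {set V} * {set {set V}}} :=
  [set p | `[< subgraph VT ET p.1 p.2 /\ ktree k p.1 p.2 >]].

Definition subktrees_with (k : nat) (V : finType) (VT : {set V})
  (ET : {set {set V}}) (C : {set V}) : {set {set V} * {set {set V}}} :=
  [set p in subktrees k VT ET | (C \subset p.1) && (complete_edges C \subset p.2)].

Local Open Scope ring_scope.

Definition avg_order (V : finType) (P : {set {set V} * {set {set V}}}) : rat :=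
  (\sum_(p in P) (#|p.1|)%:R) / (#|P|)%:R.

Definition mu (k : nat) (V : finType) (VT : {set V}) (ET : {set {set V}}) : rat :=
  avg_order (subktrees k VT ET).

Definition mu_with (k : nat) (V : finType) (VT : {set V}) (ET : {set {set V}})
  (C : {set V}) : rat :=
  avg_order (subktrees_with k VT ET C).

(* Main.v *)
(* Root T at C: T arises from C by successively attaching vertices, each to a
   k-clique. Undoing the attachments one by one, keep for every k-clique D of what
   is left two generating functions: w D counts, by number of added vertices, the
   extensions of D into the part already removed below D, and h D counts, by order,
   the sub-k-trees inside that part that do not contain D. A sub-k-tree of what is
   left is weighted by the product of w over its k-cliques; detaching a vertex v
   from D multiplies w D by 1 + X W, where W is the product of w over the k
   cliques of D + v through v, and leaves the total weight unchanged. When only C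
   is left, w C and h C describe the sub-k-trees of T containing C and those not
   containing C, and the theorem becomes an inequality between their values and
   derivatives at 1, obtained from a system of inequalities stable under the two
   operations "hang k rooted k-trees on D + v" and "glue along D". *)
Require Import Defs.
From HB Require Import structures.
From mathcomp Require Import all_boot all_order all_algebra.
From mathcomp Require Import boolp.
From mathcomp Require Import ring lra.
Set Implicit Arguments.
Unset Strict Implicit.
Unset Printing Implicit Defensive.

Import Order.TTheory GRing.Theory Num.Theory.
Local Open Scope ring_scope.

(** * Inequalities *)

(* For a k-tree rooted at a k-clique D: [n] is its number of vertices outside D, [N]
   the number of sub-k-trees containing D, [m] their mean number of vertices outside
   D, [G] the number of all sub-k-trees with more than k vertices, and [s] the sum
   over all sub-k-trees of (order - k). *)
Definition clique_stats (n N m G s : rat) : Prop :=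
  [/\ [/\ 0 <= m, m <= n, 1 + n <= N & 1 + 2 * m <= N],
      [/\ N - 1 <= N * m, G <= N * m & n * m <= G],
      (n + 1) * (m + 1) <= G + N & m * G <= 2 * s].

(* The same for k-trees hung on cliques of D + v through v: [P] is the product of their
   [N]'s and [L], [M], [G], [s] are the sums of their [n]'s, [m]'s, [G]'s, [s]'s. *)
Definition branch_stats (L P M G s : rat) : Prop :=
  [/\ [/\ 0 <= M, M <= L, 1 + L <= P & 1 + 2 * M <= P],
      0 <= G /\ G <= P * M,
      (L + 1) * (M + 1) <= G + P & (1 + M) * G <= 2 * s + P * M].

Lemma clique_stats_trivial : clique_stats 0 1 0 0 0.
Proof. by split; [split | split | |]; lra. Qed.

Lemma branch_stats_trivial : branch_stats 0 1 0 0 0.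
Proof. by split; [split | split | |]; lra. Qed.

(* Average the lower bounds [n (2 m')] and [(2 m) n'] of the right-hand side. *)
Lemma cross_terms_le (n m N n' m' N' : rat) :
  0 <= m -> m <= n -> 1 + n <= N -> 1 + 2 * m <= N ->
  0 <= m' -> m' <= n' -> 1 + n' <= N' -> 1 + 2 * m' <= N' ->
  n * m' + n' * m <= (N - 1) * (N' - 1).
Proof.
move=> m0 mn nN mN m0' mn' nN' mN'.
have a : n * (2 * m') <= (N - 1) * (N' - 1) by apply: ler_pM; lra.
have b : (2 * m) * n' <= (N - 1) * (N' - 1) by apply: ler_pM; lra.
lra.
Qed.

(** In the product bound, adding the two hypotheses leaves the mixed terms [L * m + n * M] to be
    paid by [(P - 1) * (N - 1)], which is [cross_terms_le]. In the bound on [s], the mixed terms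
    [m * G] and [(1 + M) * G'] are absorbed through [G <= P * M] and [G' <= N * m]. *)
Lemma branch_stats_cons L P M G s n N m G' s' :
  branch_stats L P M G s -> clique_stats n N m G' s' ->
  branch_stats (L + n) (P * N) (M + m) (G + G') (s + s').
Proof.
move=> [[M0 ML LP MP] [G0 GA] GP Gs] [[m0 mn nN mN] [NA G'A nmG'] G'N G's].
have c := cross_terms_le M0 ML LP MP m0 mn nN mN.
have Mm : 0 <= M * m by apply: mulr_ge0.
have Ln : 0 <= L * n by apply: mulr_ge0; lra.
have nm : 0 <= n * m by apply: mulr_ge0; lra.
have PN : 0 <= (P - 1 - L) * N by apply: mulr_ge0; lra.
have PN1 : 0 <= (P - 1 - 2 * M) * N by apply: mulr_ge0; lra.
have LN : 0 <= L * (N - 1 - n) by apply: mulr_ge0; lra.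
have MN : 0 <= M * (N - 1 - 2 * m) by apply: mulr_ge0; lra.
have t1 : P * M <= P * M * N by rewrite ler_peMr //; [apply: mulr_ge0|]; lra.
have t2 : N * m <= N * m * P by rewrite ler_peMr //; [apply: mulr_ge0|]; lra.
have t3 : m * G <= m * (P * M) by apply: ler_wpM2l.
have t4 : M * G' <= M * (N * m) by apply: ler_wpM2l.
have t5 : P * M * (1 + m) <= P * M * N.
  by apply: ler_wpM2l; [apply: mulr_ge0|]; lra.
have t6 : N * m * (1 + M) <= N * m * P.
  by apply: ler_wpM2l; [apply: mulr_ge0|]; lra.
have t7 : m * G' <= m * (N * m) by apply: ler_wpM2l.
by split; [split | split | |]; lra.
Qed.

(** The root D gets a single attached vertex v, with k branches on D + v. The sub-k-trees containing
    D are D itself and [P] others through v, of mean excess [1 + M]. Those not containing D lie in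
    one branch. *)
Lemma clique_stats_step L P M G s :
  branch_stats L P M G s ->
  clique_stats (1 + L) (1 + P) (P * (1 + M) / (1 + P)) (P + G) (P * (1 + M) + s).
Proof.
move=> [[M0 ML LP MP] [G0 GA] GP Gs].
set m := P * (1 + M) / (1 + P).
have Nm : (1 + P) * m = P * (1 + M) by rewrite /m mulrC divfK //; lra.
have PM : 0 <= P * M by apply: mulr_ge0; lra.
have m0 : 0 <= m by rewrite /m divr_ge0 //; lra.
have mM : m <= 1 + M by rewrite /m ler_pdivrMr; lra.
have m2 : 2 * m <= P.
  rewrite /m mulrA ler_pdivrMr; last by lra.
  have : P * (2 * (1 + M)) <= P * (1 + P) by apply: ler_wpM2l; lra.
  lra.
have t1 : (1 + L) * m <= (1 + L) * (1 + M) by apply: ler_wpM2l; lra.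
have t2 : m * G <= (1 + M) * G by apply: ler_wpM2r.
have t3 : P * m <= P * (1 + M) by apply: ler_wpM2l; lra.
(* Multiplied by [1 + P], the gap is at least [(P - 1 - L) (P - M)]. *)
have t4 : (1 + L + 1) * (m + 1) <= P + G + (1 + P).
  rewrite -(ler_pM2l (_ : 0 < 1 + P)); last by lra.
  have q : 0 <= (P - 1 - L) * (P - M) by apply: mulr_ge0; lra.
  have g : 0 <= (1 + P) * (G + P - (L + 1) * (M + 1)) by apply: mulr_ge0; lra.
  have -> : (1 + P) * ((1 + L + 1) * (m + 1)) =
      (1 + L + 1) * (P * (1 + M) + 1 + P) by rewrite -Nm; ring.
  lra.
by split; [split | split | |]; lra.
Qed.

(** Here [(N1 - 1) * (N2 - 1)] counts the sub-k-trees that extend the root on both sides; by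
    [cross_terms_le] it pays for the mixed products of the [n]'s and [m]'s. In the last argument,
    [s1 - N1 * m1] comes from the sub-k-trees of the first part that do not contain the root. *)
Lemma clique_stats_glue n1 N1 m1 G1 s1 n2 N2 m2 G2 s2 :
  clique_stats n1 N1 m1 G1 s1 -> clique_stats n2 N2 m2 G2 s2 ->
  clique_stats (n1 + n2) (N1 * N2) (m1 + m2) ((N1 - 1) * (N2 - 1) + G1 + G2)
    (N1 * N2 * (m1 + m2) + (s1 - N1 * m1) + (s2 - N2 * m2)).
Proof.
move=> [[m01 mn1 nN1 mN1] [NA1 GA1 nmG1] GN1 Gs1].
move=> [[m02 mn2 nN2 mN2] [NA2 GA2 nmG2] GN2 Gs2].
have c := cross_terms_le m01 mn1 nN1 mN1 m02 mn2 nN2 mN2.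
have p1 : 0 <= (N1 - 1) * (N2 - 1) by apply: mulr_ge0; lra.
have n12 : 0 <= n1 * n2 by apply: mulr_ge0; lra.
have m12 : 0 <= m1 * m2 by apply: mulr_ge0; lra.
have a1 : 0 <= n1 * (N2 - 1 - n2) by apply: mulr_ge0; lra.
have a2 : 0 <= (N1 - 1 - n1) * N2 by apply: mulr_ge0; lra.
have a3 : 0 <= m1 * (N2 - 1 - 2 * m2) by apply: mulr_ge0; lra.
have a4 : 0 <= (N1 - 1 - 2 * m1) * N2 by apply: mulr_ge0; lra.
have b1 : (N1 - 1) * (N2 - 1) <= N1 * m1 * (N2 - 1) by apply: ler_wpM2r; lra.
have b2 : (N2 - 1) * (N1 - 1) <= N2 * m2 * (N1 - 1) by apply: ler_wpM2r; lra.
have d1 : m1 * N1 * (m2 + 1) <= m1 * N1 * N2.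
  by apply: ler_wpM2l; [apply: mulr_ge0|]; lra.
have d2 : m2 * N2 * (m1 + 1) <= m2 * N2 * N1.
  by apply: ler_wpM2l; [apply: mulr_ge0|]; lra.
have e1 : m1 * G2 <= m1 * (N2 * m2) by apply: ler_wpM2l.
have e2 : m2 * G1 <= m2 * (N1 * m1) by apply: ler_wpM2l.
have f1 : 0 <= m1 * (N2 - 1) by apply: mulr_ge0; lra.
have f2 : 0 <= m2 * (N1 - 1) by apply: mulr_ge0; lra.
by split; [split | split | |]; lra.
Qed.

(* The two sides are [mu(T; C)] and [2 mu(T)]. *)
Lemma clique_stats_mean (k n N m G s : rat) :
  1 <= k -> clique_stats n N m G s ->
  (k * N + N * m) / N < 2 * ((k * (1 + k * n + G) + s) / (1 + k * n + G)).
Proof.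
move=> k1 [[m0 mn nN mN] [NA GA nmG] GN Gs].
have nm : 0 <= n * m by apply: mulr_ge0; lra.
have kn : n <= k * n by apply: ler_peMl; lra.
have kkn : k * n <= k * (k * n) by apply: ler_wpM2l; lra.
have kG : k * (n * m) <= k * G by apply: ler_wpM2l; lra.
have -> : (k * N + N * m) / N = k + m by field; lra.
(* The left side is [k + m]. Since [m * G <= 2 * s], it suffices that
   [m + k * n * m < k + k * k * n + k * G], which follows from [n * m <= G] and [m <= n]. *)
rewrite mulrA ltr_pdivlMr; lra.
Qed.

(** * Generating functions *)

(* A k-tree with [n] vertices outside the root has [1 + k n] k-cliques, so the total
   number of sub-k-trees is [1 + k n + G]. *)
Definition clique_gf (k : nat) (w h : {poly rat}) : Prop :=
  exists n m G s, [/\ clique_stats n w.[1] m G s, w^`().[1] = w.[1] * m,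
    w.[1] + h.[1] = 1 + k%:R * n + G &
    w^`().[1] + h^`().[1] - k%:R * h.[1] = s].

(** [H] counts all sub-k-trees of [r] branches by order; those of order k are the k-cliques,
    [1 + k n] for each branch. *)
Definition branch_gf (k r : nat) (W H : {poly rat}) : Prop :=
  exists L M G s, [/\ branch_stats L W.[1] M G s, W^`().[1] = W.[1] * M,
    H.[1] = r%:R + k%:R * L + G & H^`().[1] - k%:R * H.[1] = s].

Lemma clique_gf_trivial k : clique_gf k 1 0.
Proof.
exists 0, 0, 0, 0; rewrite !hornerE derivC deriv0 !hornerE.
split; first exact: clique_stats_trivial; ring.
Qed.

Lemma branch_gf_cons k r W H w h : branch_gf k r W H -> clique_gf k w h ->
  branch_gf k r.+1 (W * w) (H + ('X^k * w + h)).
Proof.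
move=> [L [M [G [s [st W' H1 H']]]]] [n [m [G' [s' [st' w' h1 h']]]]].
exists (L + n), (M + m), (G + G'), (s + s').
split.
- by rewrite hornerM; apply: branch_stats_cons.
- by rewrite derivM !hornerE W' w'; ring.
- have -> : (H + ('X^k * w + h)).[1] = H.[1] + (w.[1] + h.[1]).
    by rewrite !hornerE !expr1n mul1r.
  by rewrite h1 H1 -natr1; ring.
- rewrite !derivD derivM derivXn !(hornerD, hornerM, hornerMn, hornerXn) !expr1n.
  by rewrite -H' -h'; ring.
Qed.

Lemma branch_gf_prod k (I : Type) (r : seq I) (w h : I -> {poly rat}) :
  (forall i, clique_gf k (w i) (h i)) ->
  branch_gf k (size r) (\prod_(i <- r) w i) (\sum_(i <- r) ('X^k * w i + h i)).
Proof.
move=> gf; elim: r => [|i r IH] /=.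
  rewrite !big_nil; exists 0, 0, 0, 0; rewrite !hornerE derivC deriv0 !hornerE.
  split; first exact: branch_stats_trivial; ring.
rewrite !big_cons mulrC addrC; exact: branch_gf_cons.
Qed.

(** [1 + 'X * W] belongs to the root with the one new vertex and its branches, covered by
    [clique_stats_step]; multiplying it by [w] glues this to what already hangs on the root. *)
Lemma clique_gf_step k w h W H : clique_gf k w h -> branch_gf k k W H ->
  clique_gf k (w * (1 + 'X * W)) (h + H).
Proof.
move=> [n [m [G [s [st w' h1 h']]]]] [L [M [G' [s' [st' W' H1 H']]]]].
have stb := clique_stats_step st'.
have P0 : 1 + W.[1] != 0.
  by have [[M0 _ _ MP] _ _ _] := st'; apply: lt0r_neq0; lra.
have := clique_stats_glue st stb.
set n' := _ + (1 + L); set m' := m + _; set G2 := _ + _ + _; set s2 := _ + _ + _ => st2.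
have m'E : (1 + W.[1]) * m' = (1 + W.[1]) * m + W.[1] * (1 + M).
  by rewrite /m'; field.
have wm : w.[1] * (1 + W.[1]) * m' = w.[1] * ((1 + W.[1]) * m + W.[1] * (1 + M)).
  by rewrite -mulrA m'E.
have e1 : (1 : {poly rat}).[1] = 1 by rewrite hornerE.
exists n', m', G2, s2; split.
- by rewrite !hornerE.
- rewrite derivM derivD derivC derivM derivX.
  rewrite !(hornerD, hornerM, e1, horner0, hornerX) W' w'.
  by rewrite mul1r wm; ring.
- rewrite !(hornerD, hornerM, e1, horner0, hornerX) /n' /G2 H1.
  have -> : h.[1] = 1 + k%:R * n + G - w.[1] by rewrite -h1; ring.
  ring.
- rewrite derivM !derivD derivC derivM derivX !(hornerD, hornerM, e1, horner0, hornerX).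
  rewrite /s2 -h' -H' w' W' mul1r wm.
  have -> : (1 + W.[1]) * (W.[1] * (1 + M) / (1 + W.[1])) = W.[1] * (1 + M) by field.
  ring.
Qed.

(** * k-trees and their k-cliques *)

Lemma big_setU_disjoint (R : Type) (idx : R) (op : Monoid.com_law idx) (I : finType)
    (A B : {set I}) (F : I -> R) : [disjoint A & B] ->
  \big[op/idx]_(i in A :|: B) F i =
    op (\big[op/idx]_(i in A) F i) (\big[op/idx]_(i in B) F i).
Proof. by move=> dAB; rewrite -bigU //; apply: eq_bigl => i; rewrite !inE. Qed.

Section Graphs.
Variables (k : nat) (V : finType).
Implicit Types (S C D : {set V}) (E F : {set {set V}}) (p : {set V} * {set {set V}}).

Definition star (v : V) C : {set {set V}} := [set [set v; c] | c in C].
Definition attach (v : V) C p := (v |: p.1, p.2 :|: star v C).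
Definition kcliques p : {set {set V}} :=
  [set D : {set V} | [&& D \subset p.1, #|D| == k & complete_edges D \subset p.2]].
Definition nbrs F (v : V) := [set c | [set v; c] \in F].
Definition del_edges F (v : V) := [set e in F | v \notin e].
Definition swap (v : V) C (x : V) := v |: C :\ x.

Lemma cliqueP E C : is_clique E C <-> complete_edges C \subset E.
Proof.
split=> [cl | /subsetP sub x y xC yC xy].
  apply/subsetP => e; rewrite inE => /andP[eC /cards2P[x] [y] [xy eE]].
  move: eC; rewrite eE subUset !sub1set => /andP[xC yC].
  exact: cl.
by apply: sub; rewrite inE subUset !sub1set xC yC cards2 xy.
Qed.

Lemma starP v C e : reflect (exists2 c, c \in C & e = [set v; c]) (e \in star v C).
Proof. exact: imsetP. Qed.

Lemma pair_inj (v a b : V) : [set v; a] = [set v; b] -> a = b.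
Proof.
move=> eq; have := set22 v a; rewrite eq !inE => /orP[/eqP av|/eqP //].
by have := set22 v b; rewrite -eq av !inE orbb => /eqP ->.
Qed.

Lemma mem_star v C c : ([set v; c] \in star v C) = (c \in C).
Proof.
apply/starP/idP => [[d dC /pair_inj ->] // | cC]; by exists c.
Qed.

Lemma complete_edgesU1 v S : v \notin S ->
  complete_edges (v |: S) = complete_edges S :|: star v S.
Proof.
move=> vS; apply/setP => e; rewrite !inE; apply/andP/orP.
  move=> [eS e2]; have [ve | ve] := boolP (v \in e).
    right; have /cards1P[c ec] : #|e :\ v| == 1%N.
      by rewrite (cardsD1 v) ve eqSS in e2; rewrite e2.
    apply/starP; exists c; last by rewrite -(setD1K ve) ec.
    have : c \in e :\ v by rewrite ec set11.
    by rewrite !inE => /andP[/negbTE cv /(subsetP eS)]; rewrite !inE cv.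
  left; rewrite e2 andbT; apply/subsetP => x xe.
  have := subsetP eS _ xe; rewrite !inE => /orP[/eqP xv|//].
  by rewrite -xv xe in ve.
move=> [/andP[eS ->] | /starP[c cS ->]].
  by split=> //; apply: subset_trans eS (subsetUr _ _).
rewrite subUset !sub1set !inE eqxx cS orbT cards2.
by have -> : v != c by apply: contra vS => /eqP ->.
Qed.

(** * Vertex degrees and removal of a vertex of degree k *)

Lemma ktree_edges S F : ktree k S F -> F \subset complete_edges S.
Proof.
elim=> [{}S _ // | {}S E C v _ IH vS CS _ _].
rewrite complete_edgesU1 //; apply: setUSS => //.
exact: imsetS.
Qed.

Lemma edge_sub S F e : F \subset complete_edges S -> e \in F -> e \subset S.
Proof. by move=> /subsetP sub /sub; rewrite inE => /andP[]. Qed.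

Lemma edge_notin S F e v :
  F \subset complete_edges S -> v \notin S -> e \in F -> v \notin e.
Proof. by move=> sub vS /(edge_sub sub) eS; apply: contra vS; apply: (subsetP eS). Qed.

Lemma ktree_card S F : ktree k S F -> (k <= #|S|)%N.
Proof.
elim=> [{}S -> // | {}S E C v _ IH vS _ _ _].
by rewrite cardsU1 vS; apply: leq_trans IH _.
Qed.

Lemma ktree_card_eq S F : ktree k S F -> #|S| = k -> F = complete_edges S.
Proof.
case=> [// | {}S E C v /ktree_card kS vS _ _ _].
by rewrite cardsU1 vS => eq; rewrite -eq ltnn in kS.
Qed.

(** Settles the case of k + 1 vertices in the two inductions below, where the k-tree before the last
    attachment is too small for the induction hypothesis. *)
Lemma ktree_succ S F D v : ktree k S F -> #|S| = k -> D \subset S -> #|D| = k ->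
  v \notin S -> D = S /\ F :|: star v D = complete_edges (v |: S).
Proof.
move=> /ktree_card_eq FE cS DS cD vS.
have DE : D = S by apply/eqP; rewrite eqEcard DS cS cD leqnn.
by rewrite complete_edgesU1 // DE FE.
Qed.

Lemma nbrs_complete S v : v \in S -> nbrs (complete_edges S) v = S :\ v.
Proof.
move=> vS; apply/setP => c; rewrite !inE subUset !sub1set vS cards2 /= andbC eqSS.
by rewrite eqb1 eq_sym.
Qed.

Lemma del_complete S v : del_edges (complete_edges S) v = complete_edges (S :\ v).
Proof.
by apply/setP => e; rewrite !inE subsetD1 andbAC.
Qed.

Lemma nbrs_attach S F D u : F \subset complete_edges S -> u \notin S ->
  nbrs (F :|: star u D) u = D.
Proof.
move=> sub uS; apply/setP => c; rewrite !inE mem_star orb_idl // => ein.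
by have := edge_notin sub uS ein; rewrite !inE eqxx.
Qed.

Lemma del_attach S F D u : F \subset complete_edges S -> u \notin S ->
  del_edges (F :|: star u D) u = F.
Proof.
move=> sub uS; apply/setP => e; rewrite !inE; apply/andP/idP => [[/orP[//|]]|eF].
  by case/starP => c _ ->; rewrite !inE eqxx.
by rewrite eF (edge_notin sub uS eF).
Qed.

Lemma nbrs_min S F v : ktree k S F -> (k < #|S|)%N -> v \in S -> (k <= #|nbrs F v|)%N.
Proof.
elim=> [{}S -> | {}S E D u tS IH uS DS cD _]; first by rewrite ltnn.
move=> _; have [-> _ | vu] := eqVneq v u.
  by rewrite (nbrs_attach _ (ktree_edges tS)) // cD.
rewrite in_setU1 (negPf vu) /= => vS.
have := ktree_card tS; rewrite leq_eqVlt => /orP[/eqP cS | kS].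
  have [_ ->] := ktree_succ tS (esym cS) DS cD uS.
  rewrite nbrs_complete ?setU1r //.
  have := cardsD1 v (u |: S); rewrite cardsU1 uS setU1r // -cS => /addnI <-; apply: leqnn.
apply: leq_trans (IH kS vS) (subset_leq_card _).
by apply/subsetP => c; rewrite !inE => ->.
Qed.

(** A vertex of degree k can be taken for the last one attached: unless the graph has only k + 1
    vertices, the true last vertex [u] is [v] itself or was not attached to [v], and then deleting
    [v] commutes with attaching [u]. *)
Lemma ktree_del S F v :
  ktree k S F -> (k < #|S|)%N -> v \in S -> (#|nbrs F v| <= k)%N ->
  [/\ ktree k (S :\ v) (del_edges F v), nbrs F v \subset S :\ v,
      #|nbrs F v| = k & is_clique (del_edges F v) (nbrs F v)].
Proof.
elim=> [{}S -> | {}S E D u tS IH uS DS cD clD]; first by rewrite ltnn.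
move=> kuS; have [-> _ _ | vu] := eqVneq v u.
  have sub := ktree_edges tS.
  by rewrite (nbrs_attach _ sub) // (del_attach _ sub) // setU1K.
rewrite in_setU1 (negPf vu) /= => vS.
have := ktree_card tS; rewrite leq_eqVlt => /orP[/eqP cS _ | kS nk].
  have [_ ->] := ktree_succ tS (esym cS) DS cD uS.
  have vuS : v \in u |: S by rewrite setU1r.
  have cSv : #|(u |: S) :\ v| = k.
    by have := cardsD1 v (u |: S); rewrite cardsU1 uS vuS -cS => /addnI <-.
  rewrite nbrs_complete // del_complete; split=> //; first exact: ktree_base.
  exact/cliqueP.
(* Otherwise [v] would lose its neighbour [u] in the smaller k-tree and have fewer than k neighbours
   there, against [nbrs_min]. *)
have vD : v \notin D.
  apply: contraTN (nbrs_min tS kS vS) => vD; rewrite -ltnNge.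
  apply: leq_trans nk; apply: proper_card; apply/properP; split.
    by apply/subsetP => c; rewrite !inE => ->.
  exists u; first by rewrite inE in_setU setUC mem_star vD orbT.
  rewrite inE; apply/negP => /(edge_notin (ktree_edges tS) uS).
  by rewrite !inE eqxx orbT.
have nE : nbrs (E :|: star u D) v = nbrs E v.
  apply/setP => c; rewrite !inE orb_idr // => /starP[d dD eq].
  have := set21 v c; rewrite eq !inE (negPf vu) /= => /eqP vd.
  by rewrite vd dD in vD.
have dE : del_edges (E :|: star u D) v = del_edges E v :|: star u D.
  apply/setP => e; rewrite !inE andb_orl; congr orb.
  apply: andb_idr => /starP[d dD ->]; rewrite !inE (negPf vu) /=.
  by apply: contra vD => /eqP ->.
rewrite nE in nk; have [tD nS nc ncl] := IH kS vS nk.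
have -> : (u |: S) :\ v = u |: S :\ v.
  by apply/setP => x; rewrite !inE; case: (eqVneq x u) => [->|//]; rewrite eq_sym vu.
rewrite nE dE; split=> //.
- apply: ktree_step => //; first by rewrite !inE negb_and uS orbT.
    by rewrite subsetD1 DS.
  move=> x y xD yD xy; rewrite inE clD // !inE negb_or.
  by rewrite /=; apply/andP; split; apply: contra vD => /eqP ->.
- exact: subset_trans nS (subsetUr _ _).
- by move=> x y xn yn xy; rewrite inE ncl.
Qed.

(** * The k-cliques after an attachment *)

Lemma swap_inj v C : v \notin C -> {in C &, injective (swap v C)}.
Proof.
move=> vC x y xC yC eq; apply/eqP; apply: contraFT (setD11 x C) => xy.
have : x \in swap v C y by rewrite !inE xy xC orbT.
rewrite -eq !inE eqxx /= orbF => /eqP xv.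
by rewrite -xv xC in vC.
Qed.

Lemma card_swap v C x : v \notin C -> x \in C -> #|swap v C x| = #|C|.
Proof. by move=> vC xC; rewrite cardsU1 !inE (negPf vC) andbF (cardsD1 x C) xC. Qed.

Lemma kcliques_clique p C :
  (C \in kcliques p) <-> [/\ C \subset p.1, #|C| = k & is_clique p.2 C].
Proof.
rewrite inE; split; first by case/and3P=> -> /eqP -> /cliqueP.
by case=> -> -> /cliqueP ->; rewrite eqxx.
Qed.

(** All neighbours of [v] lie in [C], so a k-clique through [v] has its other k - 1 vertices in [C]
    and misses exactly one vertex [x] of [C]. *)
Lemma kcliques_attach v C p :
  p.2 \subset complete_edges p.1 -> v \notin p.1 -> C \in kcliques p ->
  kcliques (attach v C p) = kcliques p :|: swap v C @: C.
Proof.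
case: p => S E /= sub vS Ck; have /kcliques_clique[/= CS cC clC] := Ck.
have vC : v \notin C by apply: contra vS; apply: (subsetP CS).
apply/setP => D; rewrite in_setU; apply/idP/orP.
  move=> /kcliques_clique[/= DS cD clD]; have [vD | vD] := boolP (v \in D).
    right; have DC : D :\ v \subset C.
      apply/subsetP => d; rewrite !inE => /andP[dv dD].
      have := clD v d vD dD; rewrite eq_sym dv !inE mem_star => /(_ isT) /orP[|//].
      by move=> /(edge_notin sub vS); rewrite !inE eqxx.
    have /cards1P[x Cx] : #|C :\: (D :\ v)| == 1%N.
      rewrite cardsD (setIidPr DC) cC -cD (cardsD1 v D) vD.
      by rewrite addnK.
    have xin : x \in C :\: (D :\ v) by rewrite Cx set11.
    apply/imsetP; exists x; first by case/setDP: xin.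
    rewrite /swap -Cx setDDr setDv set0U (setIidPr DC) setD1K //.
  left; apply/kcliques_clique; split=> //=.
    apply/subsetP => d dD; have := subsetP DS _ dD; rewrite !inE => /orP[/eqP dv|//].
    by rewrite -dv dD in vD.
  move=> x y xD yD xy; have := clD x y xD yD xy; rewrite inE => /orP[//|].
  case/starP => c _ eq; have : v \in [set x; y] by rewrite eq set21.
  by rewrite !inE => /orP[] /eqP vE; rewrite vE ?xD ?yD in vD.
move=> [|/imsetP[x xC ->]]; last first.
  apply/kcliques_clique; split=> /=.
  - by apply: setUS; apply: subset_trans (subD1set _ _) CS.
  - by rewrite card_swap.
  apply/cliqueP; rewrite complete_edgesU1; last by rewrite !inE (negPf vC) andbF.
  apply: setUSS; last by apply: imsetS; apply: subD1set.
  apply/cliqueP => a b /setD1P[_ aC] /setD1P[_ bC]; exact: clC.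
rewrite !inE /= => /and3P[DS -> cl].
by rewrite (subset_trans DS (subsetUr _ _)) (subset_trans cl (subsetUl _ _)).
Qed.

(** * Starting the construction at a prescribed k-clique *)

Inductive rooted_ktree C : {set V} -> {set {set V}} -> Prop :=
| rooted_base : #|C| = k -> rooted_ktree C C (complete_edges C)
| rooted_step S E D v : rooted_ktree C S E -> v \notin S -> D \in kcliques (S, E) ->
    rooted_ktree C (v |: S) (E :|: star v D).

Lemma rooted_ktree_ktree C S E : rooted_ktree C S E -> ktree k S E.
Proof.
elim=> [|{}S {}E D v _ tS vS /kcliques_clique[DS cD clD]]; first exact: ktree_base.
exact: ktree_step.
Qed.

Lemma rooted_ktree_root C S E : rooted_ktree C S E -> C \subset S.
Proof. by elim=> // {}S {}E D v _ CS _ _; apply: subset_trans CS (subsetUr _ _). Qed.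

(** If only [C] is present, [v |: C] is complete and [x] can be attached last in place of [v]. Later
    attachments commute with that of [v]. *)
Lemma reroot C S E v x : rooted_ktree C S E -> v \notin S -> x \in C ->
  rooted_ktree (swap v C x) (v |: S) (E :|: star v C).
Proof.
move=> T; elim: T => [cC vC xC | {}S {}E D u T IH uS Dk vuS xC].
  have xs : x \notin swap v C x.
    by rewrite !inE eqxx orbF; apply: contra vC => /eqP <-.
  have eq : x |: swap v C x = v |: C by rewrite setUCA setD1K.
  rewrite -complete_edgesU1 // -eq complete_edgesU1 //.
  apply: rooted_step => //; first by apply: rooted_base; rewrite card_swap.
  by apply/kcliques_clique; split=> //; rewrite ?card_swap //; apply/cliqueP.
have vS : v \notin S by apply: contra vuS; apply: setU1r.
rewrite setUCA setUAC; apply: rooted_step; first exact: IH.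
  rewrite !inE (negPf uS) orbF; apply: contra vuS => /eqP ->; exact: setU11.
move: Dk; rewrite !inE /= => /and3P[DS -> cl].
by rewrite (subset_trans DS (subsetUr _ _)) (subset_trans cl (subsetUl _ _)).
Qed.

(** A k-clique created with the last vertex [v] is some [swap v D x]; the smaller k-tree is first
    rooted at [D], and [reroot] moves the root. *)
Lemma ktree_rooted C S E : ktree k S E -> C \in kcliques (S, E) -> rooted_ktree C S E.
Proof.
move=> T; elim: T C => [{}S cS C /kcliques_clique[/= CS cC _]
  | {}S {}E D v T IH vS DS cD clD C].
  have -> : C = S by apply/eqP; rewrite eqEcard CS cS cC leqnn.
  exact: rooted_base.
have Dk : D \in kcliques (S, E) by apply/kcliques_clique.
rewrite -[(_, _)]/(attach v D (S, E)) kcliques_attach //; last exact: ktree_edges.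
rewrite in_setU => /orP[Ck | /imsetP[x xD ->]].
  by apply: rooted_step => //; apply: IH.
by apply: reroot => //; apply: IH.
Qed.

(** * Sub-k-trees after an attachment *)

Lemma subktreesP S E p :
  reflect (subgraph S E p.1 p.2 /\ ktree k p.1 p.2) (p \in subktrees k S E).
Proof. by rewrite inE; apply: asboolP. Qed.

Lemma subktrees_withE S E C : #|C| = k ->
  subktrees_with k S E C = [set p in subktrees k S E | C \in kcliques p].
Proof. by move=> cC; apply/setP => p; rewrite !inE cC eqxx. Qed.

(** The three families are the sub-k-trees avoiding [v], those through [v] of order above k, and
    those through [v] of order k. In the second, [v] has at most k neighbours, so [ktree_del]
    removes it and its neighbourhood is all of [D]. *)
Lemma subktrees_attach S E D v : ktree k S E -> v \notin S -> D \in kcliques (S, E) ->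
  subktrees k (v |: S) (E :|: star v D) =
    subktrees k S E
    :|: attach v D @: [set p in subktrees k S E | D \in kcliques p]
    :|: [set (swap v D x, complete_edges (swap v D x)) | x in D].
Proof.
move=> tS vS Dk; have sub := ktree_edges tS.
have /kcliques_clique[/= DS cD clD] := Dk.
have vD : v \notin D by apply: contra vS; apply: (subsetP DS).
have tT : ktree k (v |: S) (E :|: star v D) by exact: ktree_step.
apply/setP => -[X F]; rewrite !in_setU; apply/subktreesP/orP => /=.
  case=> -[/= XS FE FX] tX; have [vX | vX] := boolP (v \in X); last first.
    left; apply/orP; left; apply/subktreesP; split=> //; split=> //=.
      apply/subsetP => x xX; have := subsetP XS _ xX.
      by rewrite !inE => /orP[/eqP xv|//]; rewrite -xv xX in vX.
    apply/subsetP => e eF; have := subsetP FE _ eF; rewrite inE => /orP[//|].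
    case/starP => c _ ee; have := subsetP (FX _ eF) v.
    by rewrite ee set21 (negPf vX) => /(_ isT).
  have := ktree_card tX; rewrite leq_eqVlt => /orP[/eqP cX | kX].
    right; have FX' := ktree_card_eq tX (esym cX).
    have : X \in kcliques (attach v D (S, E)).
      by rewrite inE XS -cX eqxx -FX' FE.
    rewrite kcliques_attach // in_setU => /orP[/kcliques_clique[/subsetP XS' _ _]|].
      by rewrite (negPf (contra (XS' v) vS)) in vX.
    by case/imsetP => x xD eX; apply/imsetP; exists x => //; rewrite FX' eX.
  left; apply/orP; right.
  have nD : nbrs F v \subset D.
    rewrite -(nbrs_attach D sub vS); apply/subsetP => c.
    by rewrite !(in_set (fun c => _ \in _)) => /(subsetP FE).
  have nk : (#|nbrs F v| <= k)%N by rewrite -cD subset_leq_card.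
  have [tX' nX nc ncl] := ktree_del tX kX vX nk.
  have nE : nbrs F v = D by apply/eqP; rewrite eqEcard nD nc cD leqnn.
  rewrite nE in nX ncl.
  apply/imsetP; exists (X :\ v, del_edges F v); last first.
    rewrite /attach /= setD1K //; congr (_, _).
    apply/setP => e; rewrite in_setU inE; apply/idP/orP => [eF | [/andP[]//|]].
      have [ve | ve] := boolP (v \in e); last by left; rewrite eF.
      right; have := subsetP FE _ eF; rewrite inE => /orP[eE | //].
      by rewrite (negPf (edge_notin sub vS eE)) in ve.
    by case/starP => c; rewrite -nE inE => cin ->.
  rewrite inE; apply/andP; split; last by apply/kcliques_clique.
  apply/subktreesP; split=> //; split=> /=.
  - by rewrite subDset.
  - rewrite -(del_attach D sub vS); apply/subsetP => e.
    by rewrite !(in_set (fun e => _ && _)) => /andP[/(subsetP FE) -> ->].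
  - move=> e; rewrite inE subsetD1 => /andP[eF ->].
    by rewrite (FX _ eF).
have wk (Y : {set V}) : Y \subset S -> Y \subset v |: S.
  by move=> YS; apply: subset_trans YS (subsetUr _ _).
case=> [/orP[/subktreesP[[/= XS FE FX] tX] | /imsetP[[Y F']]] | /imsetP[x xD]].
- split=> //; split=> //=; first exact: wk.
  exact: subset_trans FE (subsetUl _ _).
- rewrite inE => /andP[/subktreesP[[/= YS FE FY] tY] /kcliques_clique[/= DY _ clY]].
  rewrite /attach /= => -[-> ->].
  have vY : v \notin Y by apply: contra vS; apply: (subsetP YS).
  have tX : ktree k (v |: Y) (F' :|: star v D) by exact: ktree_step.
  split=> //; split; [exact: setUS | exact: setSU |].
  by move=> e; apply: edge_sub (ktree_edges tX).
- move=> [-> ->]; have : swap v D x \in kcliques (attach v D (S, E)).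
    by rewrite kcliques_attach // in_setU imset_f // orbT.
  rewrite inE /= => /and3P[sS /eqP cs sE]; split; last exact: ktree_base.
  by split=> // e; apply: edge_sub.
Qed.

Lemma attach_inj v C (A : {set {set V} * {set {set V}}}) :
  (forall p, p \in A -> v \notin p.1 /\ p.2 \subset complete_edges p.1) ->
  {in A &, injective (attach v C)}.
Proof.
move=> hA [X F] [Y F'] /hA[/= vX sX] /hA[/= vY sY] [eq1 eq2].
congr (_, _); first by rewrite -(setU1K vX) eq1 setU1K.
by rewrite -(del_attach C sX vX) eq2 (del_attach _ sY vY).
Qed.

Lemma sum_subktrees_attach (R : nmodType) S E D v (f : _ -> R) :
  ktree k S E -> v \notin S -> D \in kcliques (S, E) ->
  \sum_(p in subktrees k (v |: S) (E :|: star v D)) f p =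
    \sum_(p in subktrees k S E)
      (f p + if D \in kcliques p then f (attach v D p) else 0)
    + \sum_(x in D) f (swap v D x, complete_edges (swap v D x)).
Proof.
move=> tS vS Dk; rewrite subktrees_attach //.
have /kcliques_clique[/= DS cD _] := Dk.
have vD : v \notin D by apply: contra vS; apply: (subsetP DS).
have old p : p \in subktrees k S E -> v \notin p.1 /\ p.2 \subset complete_edges p.1.
  case/subktreesP => -[pS _ _] tp; split; last exact: ktree_edges tp.
  by apply: contra vS; apply: (subsetP pS).
set A := subktrees k S E; set B := attach v D @: _; set K := imset _ _.
have AB : [disjoint A & B].
  rewrite -setI_eq0; apply/eqP/setP => p; rewrite in_setI in_set0; apply/negP.
  case/andP=> /old[vp _] /imsetP[q _ eq].
  by rewrite eq /= setU11 in vp.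
(* Members of [K] have order k, whereas attaching [v] to a sub-k-tree gives order above k. *)
have ABK : [disjoint A :|: B & K].
  rewrite -setI_eq0; apply/eqP/setP => p; rewrite in_setI in_set0 in_setU.
  apply/negP => /andP[/orP[/old[vp _] | /imsetP[q qAD eqq]] /imsetP[x xD eq]].
    by rewrite eq /= setU11 in vp.
  have /andP[qA _] : (q \in A) && (D \in kcliques q) by rewrite inE in qAD.
  have [vq _] := old _ qA.
  have /subktreesP[_ /ktree_card] := qA; have : #|p.1| = k by rewrite eq card_swap.
  by rewrite eqq /= cardsU1 vq => <-; rewrite ltnn.
rewrite !big_setU_disjoint //=.
rewrite big_imset /=; last first.
  by apply: attach_inj => p; rewrite inE => /andP[/old].
rewrite big_imset /=; last first.
  by move=> x y xD yD [eq _]; apply: (swap_inj vD).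
rewrite big_split /=; congr (_ + _ + _).
by rewrite -big_mkcondr /=; apply: eq_bigl => p; rewrite inE.
Qed.

End Graphs.

(** * Elimination of vertices *)

Section Weights.
Variables (k : nat) (V : finType).
Implicit Types (S C D : {set V}) (E F : {set {set V}}) (p : {set V} * {set {set V}}).
Implicit Types w h : {set V} -> {poly rat}.

Definition weight w p : {poly rat} := 'X^#|p.1| * \prod_(D in kcliques k p) w D.

Definition local_gf w C S E :=
  \sum_(p in subktrees k S E | C \in kcliques k p) weight w p.

(** During elimination, a sub-k-tree of the original graph either contains a k-clique of what is
    left, and is counted by a weight, or is hidden below a single [D], and is counted by [h D]. *)
Definition global_gf w h S E :=
  \sum_(p in subktrees k S E) weight w p + \sum_(D in kcliques k (S, E)) h D.

Definition absorb_w w v D : {set V} -> {poly rat} := fun D' =>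
  if D' == D then w D * (1 + 'X * \prod_(x in D) w (swap v D x)) else w D'.

Definition absorb_h w h v D : {set V} -> {poly rat} := fun D' =>
  if D' == D then
    h D + \sum_(x in D) ('X^k * w (swap v D x) + h (swap v D x))
  else h D'.

Lemma kcliques_complete C : #|C| = k -> kcliques k (C, complete_edges C) = [set C].
Proof.
move=> cC; apply/setP => D; rewrite in_set1; apply/idP/eqP => [|->].
  move=> /kcliques_clique[/= DC cD _].
  by apply/eqP; rewrite eqEcard DC cC cD leqnn.
by rewrite inE /= !subxx cC eqxx.
Qed.

Lemma weight_complete w C : #|C| = k -> weight w (C, complete_edges C) = 'X^k * w C.
Proof. by move=> cC; rewrite /weight kcliques_complete // big_set1 cC. Qed.

Lemma big_kcliques_attach (R : Type) (idx : R) (op : Monoid.com_law idx)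
    (f : {set V} -> R) v D p :
  p.2 \subset complete_edges p.1 -> v \notin p.1 -> D \in kcliques k p ->
  \big[op/idx]_(D' in kcliques k (attach v D p)) f D' =
    op (\big[op/idx]_(D' in kcliques k p) f D')
       (\big[op/idx]_(x in D) f (swap v D x)).
Proof.
move=> sub vp Dp; rewrite kcliques_attach //.
have vc D' : D' \in kcliques k p -> v \notin D'.
  by case/kcliques_clique=> /subsetP D'p _ _; apply: contra vp; apply: D'p.
rewrite big_setU_disjoint; last first.
  rewrite -setI_eq0; apply/eqP/setP => D'; rewrite in_setI in_set0; apply/negP.
  by case/andP=> /vc vD' /imsetP[x xD eq]; rewrite eq setU11 in vD'.
by rewrite big_imset //=; apply/swap_inj/vc.
Qed.

(** Attaching [v] multiplies the weight by ['X] and by [w] of the new k-cliques, a factor depending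
    on [D] only; it can therefore be stored in the weight of [D]. *)
Lemma weight_absorb w v D p :
  p.2 \subset complete_edges p.1 -> v \notin p.1 ->
  weight w p + (if D \in kcliques k p then weight w (attach v D p) else 0) =
    weight (absorb_w w v D) p.
Proof.
move=> sub vp; case: ifPn => Dp; last first.
  rewrite addr0; congr (_ * _); apply: eq_bigr => D' D'p; rewrite /absorb_w.
  by case: eqP D'p Dp => // -> ->.
rewrite /weight big_kcliques_attach // cardsU1 vp exprS.
rewrite !(bigD1 D Dp) /= /absorb_w eqxx.
have -> : \prod_(D' in kcliques k p | D' != D)
    (if D' == D then w D * (1 + 'X * \prod_(x in D) w (swap v D x)) else w D') =
    \prod_(D' in kcliques k p | D' != D) w D'.
  by apply: eq_bigr => D' /andP[_ /negPf ->].
ring.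
Qed.

Lemma subktrees_wf S E p : p \in subktrees k S E ->
  p.1 \subset S /\ p.2 \subset complete_edges p.1.
Proof. by case/subktreesP=> -[pS _ _] /ktree_edges. Qed.

(** The new k-cliques do not contain [D]. Their own weights as sub-k-trees of order k, and their
    [h], thus move into the new [h D]. *)
Lemma global_gf_attach w h S E v D :
  ktree k S E -> v \notin S -> D \in kcliques k (S, E) ->
  global_gf w h (v |: S) (E :|: star v D) =
    global_gf (absorb_w w v D) (absorb_h w h v D) S E.
Proof.
move=> tS vS Dk; rewrite /global_gf sum_subktrees_attach //.
rewrite -[(_, _)]/(attach v D (S, E)) big_kcliques_attach ?ktree_edges //=; last first.
  exact: ktree_edges tS.
have /kcliques_clique[/= DS cD _] := Dk.
have vD : v \notin D by apply: contra vS; apply: (subsetP DS).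
have -> : \sum_(p in subktrees k S E)
      (weight w p + (if D \in kcliques k p then weight w (attach v D p) else 0)) =
    \sum_(p in subktrees k S E) weight (absorb_w w v D) p.
  apply: eq_bigr => p /subktrees_wf[pS sub]; apply: weight_absorb => //.
  by apply: contra vS; apply: (subsetP pS).
have -> : \sum_(x in D) weight w (swap v D x, complete_edges (swap v D x)) =
    \sum_(x in D) 'X^k * w (swap v D x).
  by apply: eq_bigr => x xD; rewrite weight_complete // card_swap.
rewrite -addrA; congr (_ + _).
rewrite !(bigD1 D Dk) /= {1}/absorb_h eqxx big_split /=.
have -> : \sum_(D' in kcliques k (S, E) | D' != D) absorb_h w h v D D' =
    \sum_(D' in kcliques k (S, E) | D' != D) h D'.
  by apply: eq_bigr => D' /andP[_ /negPf ne]; rewrite /absorb_h ne.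
ring.
Qed.

(** As [v] is outside [C], attaching [v] never changes whether a sub-k-tree contains [C], and the
    new single k-cliques do not contribute. *)
Lemma local_gf_attach w C S E v D :
  ktree k S E -> v \notin S -> D \in kcliques k (S, E) -> C \subset S ->
  local_gf w C (v |: S) (E :|: star v D) = local_gf (absorb_w w v D) C S E.
Proof.
move=> tS vS Dk CS; rewrite /local_gf big_mkcondr sum_subktrees_attach //=.
have vC : v \notin C by apply: contra vS; apply: (subsetP CS).
have /kcliques_clique[/= DS cD _] := Dk.
have vD : v \notin D by apply: contra vS; apply: (subsetP DS).
rewrite [X in _ + X]big1 ?addr0 => [|x xD]; last first.
  rewrite kcliques_complete ?card_swap // in_set1.
  by case: eqP vC => // ->; rewrite setU11.
rewrite [RHS]big_mkcondr; apply: eq_bigr => p /subktrees_wf[/= pS sub].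
have vp : v \notin p.1 by apply: contra vS; apply: (subsetP pS).
rewrite -weight_absorb //; case: (boolP (D \in _)) => Dp; last first.
  by rewrite !addr0.
have -> : (C \in kcliques k (attach v D p)) = (C \in kcliques k p).
  rewrite kcliques_attach // in_setU; apply/orb_idr => /imsetP[x xD eq].
  by rewrite eq setU11 in vC.
by case: ifP => // _; rewrite addr0.
Qed.

Lemma absorb_gf w h v D : #|D| = k -> (forall D', clique_gf k (w D') (h D')) ->
  forall D', clique_gf k (absorb_w w v D D') (absorb_h w h v D D').
Proof.
move=> cD gf D'; rewrite /absorb_w /absorb_h; case: eqP => // _.
apply: clique_gf_step => //.
(* There is one branch for each [x] in [D], hence k of them. *)
rewrite -!big_enum /= -[X in branch_gf _ X]cD cardE.
exact: branch_gf_prod.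
Qed.

Lemma subktrees_complete C : #|C| = k ->
  subktrees k C (complete_edges C) = [set (C, complete_edges C)].
Proof.
move=> cC; apply/setP => -[X F]; rewrite in_set1; apply/subktreesP/eqP => /=.
  case=> -[/= XC _ _] tX.
  have XE : X = C by apply/eqP; rewrite eqEcard XC cC (ktree_card tX).
  by rewrite XE in tX *; rewrite (ktree_card_eq tX cC).
move=> [-> ->]; split; last exact: ktree_base.
by split=> // e; rewrite inE => /andP[].
Qed.

(** Induction eliminates the last attached vertex, so [w] and [h] must be arbitrary: the hypothesis
    is applied to the absorbed ones. At the end only [C] remains. *)
Lemma rooted_ktree_gf C S E : rooted_ktree k C S E ->
  forall w h, (forall D, clique_gf k (w D) (h D)) ->
  exists W H, [/\ clique_gf k W H, local_gf w C S E = 'X^k * W &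
    global_gf w h S E = 'X^k * W + H].
Proof.
elim=> [cC | {}S {}E D v T IH vS Dk] w h gf.
  exists (w C), (h C); rewrite /local_gf /global_gf big_mkcondr.
  rewrite subktrees_complete // !big_set1 kcliques_complete // big_set1 set11.
  by rewrite weight_complete.
have tS := rooted_ktree_ktree T; have /kcliques_clique[_ cD _] := Dk.
have [W [H [gf0 l0 g0]]] := IH _ _ (absorb_gf v cD gf).
exists W, H; split=> //; first by rewrite local_gf_attach // (rooted_ktree_root T).
by rewrite global_gf_attach.
Qed.

Lemma weight1 p : weight (fun=> 1) p = 'X^#|p.1|.
Proof. by rewrite /weight big1 ?mulr1. Qed.

End Weights.

(** * Averages as logarithmic derivatives at 1 *)

Lemma avg_order_gf (V : finType) (P : {set {set V} * {set {set V}}}) (q : {poly rat}) :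
  \sum_(p in P) 'X^#|p.1| = q -> avg_order P = q^`().[1] / q.[1].
Proof.
move=> <-; rewrite /avg_order (raddf_sum (@deriv _)) !horner_sum; congr (_ / _).
  by apply: eq_bigr => p _; rewrite /= derivXn hornerMn hornerXn expr1n.
rewrite (eq_bigr (fun=> 1)) => [|p _]; last by rewrite hornerXn expr1n.
by rewrite sumr_const.
Qed.

Theorem theorem1p4 (k : nat) (V : finType) (VT : {set V}) (ET : {set {set V}})
  (C : {set V}) :
  (1 <= k)%N -> ktree k VT ET -> is_kclique k VT ET C ->
  mu_with k VT ET C < 2 * mu k VT ET.
Proof.
move=> k1 T [CV cC clC].
have Ck : C \in kcliques k (VT, ET) by apply/kcliques_clique.
(* Before any elimination nothing hangs below a k-clique: every [w] is 1 and every [h] is 0, so a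
   weight only records the order. *)
have [W [H [gf loc glob]]] := rooted_ktree_gf (ktree_rooted T Ck)
  (fun=> clique_gf_trivial k).
rewrite /mu_with /mu (@avg_order_gf _ _ ('X^k * W)); last first.
  rewrite -loc subktrees_withE // /local_gf.
  by apply: eq_big => p; rewrite ?inE // => _; rewrite weight1.
rewrite (@avg_order_gf _ _ ('X^k * W + H)); last first.
  rewrite -glob /global_gf [X in _ + X]big1 // addr0.
  by apply: eq_bigr => p _; rewrite weight1.
have [n [m [G [s [st W' F S]]]]] := gf.
have := @clique_stats_mean k%:R _ _ _ _ _ _ st; rewrite ler1n => /(_ k1).
rewrite derivD derivM derivXn !(hornerD, hornerM, hornerXn, hornerMn) !expr1n.
rewrite !mul1r -F -S W'; congr (_ / _ < 2 * (_ / _)).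
ring.
Qed.
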